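(* Let $\phi:\Sigma^*\to\Gamma^*$ be an injective morphism, let $u,v\in\Sigma^*$, and let $k\ge 1$ be an integer. If $\phi$ is interference-free on $\bigcup_{i=0}^{k-1}\{\phi^i(u)\}$, then $\mathrm{occ}(u,v)=\mathrm{occ}(\phi^k(u),\phi^k(v))$.
   Context: $\mathrm{occ}(u,w)$ denotes the number of positions $i$ with $w[i..i+|u|-1]=u$ (occurrences may overlap). $\phi^0(u)=u$, $\phi^i(u)=\phi(\phi^{i-1}(u))$. A morphism satisfies $\phi(uv)=\phi(u)\phi(v)$; its images are $\phi(c)$, $c\in\Sigma$. $\phi$ is injective if $\phi(u)\neq\phi(v)$ for all $u\neq v$. A word admits an image factorization if it is a concatenation of zero or more images. A word $w$ admits an interfered image factorization if $w=xyz$ with $x$ a proper (possibly empty) suffix of some image, $y$ admitting an image factorization, $z$ a proper (possibly empty) prefix of some image, and $xz\neq\varepsilon$. A word is an inner image factor if it is a proper factor of some image $\phi(c)$ that is neither a prefix nor a suffix of $\phi(c)$. For injective $\phi$, $\phi$ is interference-free on $\mathcal{L}\subseteq\Sigma^*$ if for every non-empty $u\in\mathcal{L}$, $\phi(u)$ admits no interfered image factorization and is not an inner image factor.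
   Formalization: The word u is assumed non-empty (for u = ε the claim fails, e.g. φ(a)=aa, v=a, k=1), and φ^i(u), φ^i(v) are assumed to lie in Σ* for i<k so that the iterates of φ are defined. *)

(* Defs.v *)
From mathcomp Require Import all_boot.

Set Implicit Arguments.
Unset Strict Implicit.
Unset Printing Implicit Defensive.

(* Alphabets are subsets of an ambient letter type T, so that Sigma and Gamma
   may differ while the iterates of phi : Sigma^* -> Gamma^* still make sense. *)

Definition words (T : eqType) (A : {pred T}) : {pred seq T} :=
  [pred w : seq T | all (mem A) w].

(* phi is a total function; only its restriction to Sigma^* is meaningful. *)
Definition morphism_on (T : eqType) (Sigma Gamma : {pred T})
    (phi : seq T -> seq T) : Prop :=
  (forall w, w \in words Sigma -> phi w \in words Gamma) /\
  (forall x y, x \in words Sigma -> y \in words Sigma ->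
     phi (x ++ y) = phi x ++ phi y).

(* Positions are 0-based; a truncated window (shorter than u) never equals u. *)
Definition occ (T : eqType) (u w : seq T) : nat :=
  count (fun i => take (size u) (drop i w) == u) (iota 0 (size w)).

Section Interference.

Variables (T : eqType) (Sigma : {pred T}) (phi : seq T -> seq T).

Definition is_image (w : seq T) : Prop :=
  exists2 c, c \in Sigma & w = phi [:: c].

Definition image_factorization (w : seq T) : Prop :=
  exists2 s : seq (seq T), (forall x, x \in s -> is_image x) & w = flatten s.

Definition proper_prefix (x w : seq T) : Prop := prefix x w /\ x <> w.

Definition proper_suffix (x w : seq T) : Prop := suffix x w /\ x <> w.

Definition interfered_image_factorization (w : seq T) : Prop :=
  exists x y z : seq T,
    [/\ w = x ++ y ++ z,
        exists2 p, is_image p & proper_suffix x p,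
        image_factorization y,
        exists2 q, is_image q & proper_prefix z q
      & x ++ z <> [::]].

Definition inner_image_factor (w : seq T) : Prop :=
  exists2 p, is_image p &
    [/\ infix w p, w <> p, ~~ prefix w p & ~~ suffix w p].

Definition interference_free (L : seq T -> Prop) : Prop :=
  forall w, L w -> w <> [::] ->
    ~ interfered_image_factorization (phi w) /\ ~ inner_image_factor (phi w).

End Interference.

(* Main.v *)
Require Import Defs.
From mathcomp Require Import all_boot.

Set Implicit Arguments.
Unset Strict Implicit.
Unset Printing Implicit Defensive.

(** An occurrence of [phi u] in [phi v] is compared with the cuts between
    consecutive images of letters of [v].  If it begins or ends strictly inside
    an image, then it lies inside a single image, as an inner image factor or as
    a proper prefix or suffix, or it crosses a cut; in every case but the first
    it carries an interfered image factorization.  So it begins and ends at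
    cuts, and injectivity makes it the image of an occurrence of [u] in [v].
    Hence [phi] preserves [occ u v], and the theorem follows by iterating. *)

Lemma occ_cons (T : eqType) (u : seq T) (a : T) (v : seq T) :
  occ u (a :: v) = prefix u (a :: v) + occ u v.
Proof.
by rewrite prefixE /occ /= -[1]addn0 iotaDl count_map.
Qed.

(** Serves to discard the positions strictly inside the image of a letter, with [w] a tail of that
    image and [r] the images that follow. *)
Lemma occ_cat_no_straddle (T : eqType) (u w r : seq T) :
  (forall i, i < size w -> ~~ prefix u (drop i w ++ r)) ->
  occ u (w ++ r) = occ u r.
Proof.
elim: w => //= a w IHw nou.
rewrite occ_cons IHw; last by move=> i ltiw; apply: (nou i.+1).
by have := nou 0 isT; rewrite /= => /negPf ->.
Qed.

Lemma words_prefix (T : eqType) (A : {pred T}) (w v : seq T) :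
  prefix w v -> v \in words A -> w \in words A.
Proof. by case/prefixP=> s ->; rewrite !inE all_cat => /andP[]. Qed.

Section InjectiveMorphism.

Variables (T : eqType) (Sigma Gamma : {pred T}) (phi : seq T -> seq T).
Hypothesis phiM : morphism_on Sigma Gamma phi.
Hypothesis phi_inj : {in words Sigma &, injective phi}.

Lemma morphism_on_nil : phi [::] = [::].
Proof.
have /(congr1 size) := phiM.2 [::] [::] isT isT.
by rewrite size_cat -[LHS]addn0 => /addnI/esym/size0nil.
Qed.

Lemma morphism_on_cons (a : T) (v : seq T) :
  a \in Sigma -> v \in words Sigma -> phi (a :: v) = phi [:: a] ++ phi v.
Proof. by move=> aS vS; rewrite -phiM.2 // inE /= aS. Qed.

Lemma injective_morphism_neq0 (u : seq T) :
  u \in words Sigma -> u <> [::] -> phi u <> [::].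
Proof.
move=> uS u0 phiu0; apply/u0/phi_inj => //.
by rewrite phiu0 morphism_on_nil.
Qed.

Lemma image_factorization_morphism (v : seq T) :
  v \in words Sigma -> image_factorization Sigma phi (phi v).
Proof.
move=> vS; exists [seq phi [:: c] | c <- v].
  by move=> _ /mapP[c cv ->]; exists c => //; apply: (allP vS).
elim: v vS => [_|a v IHv /= /andP[aS vS]]; first exact: morphism_on_nil.
by rewrite morphism_on_cons // IHv.
Qed.

Lemma proper_prefix_nil_image (c : T) :
  c \in Sigma -> proper_prefix [::] (phi [:: c]).
Proof.
move=> cS; split; first exact: prefix0s.
by apply/nesym/injective_morphism_neq0 => //; rewrite inE /= cS.
Qed.

Lemma proper_suffix_nil_image (c : T) :
  c \in Sigma -> proper_suffix [::] (phi [:: c]).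
Proof.
move=> cS; split; first exact: suffix0s.
by case: (proper_prefix_nil_image cS).
Qed.

(* The letter [c] only serves to exhibit an image when [z] is empty. *)
Lemma prefix_morphism_split (c : T) (w v : seq T) :
  c \in Sigma -> v \in words Sigma -> prefix w (phi v) ->
  exists v1 z, [/\ prefix v1 v, w = phi v1 ++ z &
    exists2 q, is_image Sigma phi q & proper_prefix z q].
Proof.
move=> cS; elim: v w => [|a v IHv] w.
  move=> _; rewrite morphism_on_nil prefixs0 => /eqP ->.
  exists [::], [::]; rewrite morphism_on_nil; split=> //.
  by exists (phi [:: c]); [exists c | apply: proper_prefix_nil_image].
move=> /= /andP[aS vS]; rewrite morphism_on_cons //.
(* A [w] shorter than the first image is itself the remainder [z]. At equal length the letter [a]
   already goes into [v1], which keeps [z] a proper prefix. *)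
have [ltwa|lewa] := ltnP (size w) (size (phi [:: a])).
  move=> pw; exists [::], w; rewrite morphism_on_nil; split=> //.
  exists (phi [:: a]); first by exists a.
  split; last by move=> E; rewrite E ltnn in ltwa.
  by move: pw; rewrite !prefixE takel_cat // ltnW.
move=> /prefixP[r Er].
have Ew : w = phi [:: a] ++ drop (size (phi [:: a])) w.
  rewrite -{1}(cat_take_drop (size (phi [:: a])) w); congr (_ ++ _).
  by rewrite -(takel_cat r lewa) -Er take_size_cat.
have [|v1 [z [pv1 Ez qz]]] := IHv (drop (size (phi [:: a])) w) vS.
  move/eqP: Er; rewrite Ew -catA eqseq_cat // eqxx => /eqP ->.
  by rewrite drop_size_cat // prefix_prefix.
exists (a :: v1), z; split=> //; first by rewrite /= eqxx.
have v1S : v1 \in words Sigma := words_prefix pv1 vS.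
by rewrite morphism_on_cons // -catA -Ez.
Qed.

Section SingleWord.

Variable u : seq T.
Hypotheses (uS : u \in words Sigma) (u_neq0 : u <> [::]).
Hypothesis u_free : ~ interfered_image_factorization Sigma phi (phi u).
Hypothesis u_outer : ~ inner_image_factor Sigma phi (phi u).

(** Cutting [phi u] along the images of the letters of [v] leaves a remainder [z]. If [z] is
    non-empty, it gives an interfered factorization with empty left part; otherwise injectivity
    identifies [u] with a prefix of [v]. *)
Lemma interference_free_prefix (v : seq T) :
  v \in words Sigma -> prefix (phi u) (phi v) = prefix u v.
Proof.
move=> vS; apply/idP/idP => [|/prefixP[s Es]]; last first.
  move: vS; rewrite Es inE all_cat => /andP[_ sS].
  by rewrite phiM.2 // prefix_prefix.
(* The first letter [c] of [u] supplies an image of which the empty word is a proper suffix. *)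
case: u uS u_neq0 u_free => // c u' uS' _ free pv.
have /andP[/= cS _] := uS'.
have [v1 [z [pv1 Ez qz]]] := prefix_morphism_split cS vS pv.
have v1S : v1 \in words Sigma := words_prefix pv1 vS.
have [z0|/eqP z0] := eqVneq z [::].
  by rewrite z0 cats0 in Ez; rewrite (phi_inj uS' v1S Ez).
case: free; exists [::], (phi v1), z; split=> //.
  by exists (phi [:: c]); [exists c | apply: proper_suffix_nil_image].
exact: image_factorization_morphism.
Qed.

Lemma interference_free_no_straddle (a : T) (v : seq T) (i : nat) :
  a \in Sigma -> v \in words Sigma -> 0 < i < size (phi [:: a]) ->
  ~~ prefix (phi u) (drop i (phi [:: a]) ++ phi v).
Proof.
move=> aS vS /andP[i0 lti]; apply/negP => pu.
have aI : is_image Sigma phi (phi [:: a]) by exists a.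
have phiu0 := injective_morphism_neq0 uS u_neq0.
have nilF : image_factorization Sigma phi [::] by exists [::].
have ltd : size (drop i (phi [:: a])) < size (phi [:: a]).
  by rewrite size_drop ltn_subrL i0 (leq_trans _ lti).
(* Either the occurrence stays inside the image of [a], or it crosses the cut after it. *)
have [leu|/ltnW ltu] := leqP (size (phi u)) (size (drop i (phi [:: a]))).
  have neq : phi u <> phi [:: a].
    by move=> E; rewrite E leqNgt ltd in leu.
  (* Inner image factors exclude prefixes and suffixes; in those two cases [phi u] itself is the
     part [z] or [x] of an interfered factorization. *)
  have [pre|npre] := boolP (prefix (phi u) (phi [:: a])).
    apply: u_free; exists [::], [::], (phi u); split=> //.
    - by exists (phi [:: a]) => //; apply: proper_suffix_nil_image.
    - by exists (phi [:: a]).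
  have [suf|nsuf] := boolP (suffix (phi u) (phi [:: a])).
    apply: u_free; exists (phi u), [::], [::]; rewrite !cats0; split=> //.
    - by exists (phi [:: a]).
    - by exists (phi [:: a]) => //; apply: proper_prefix_nil_image.
  apply: u_outer; exists (phi [:: a]) => //; split=> //.
  move: pu; rewrite prefixE takel_cat // -prefixE => /prefixP[s Es].
  apply/infixP; exists (take i (phi [:: a])), s.
  by rewrite -Es cat_take_drop.
(* The tail [d] will be the left part [x]: it is a proper suffix because [0 < i], and non-empty
   because [i] is below the length of the image. *)
set d := drop i (phi [:: a]) in pu ltu ltd.
case/prefixP: pu => r Er.
have Eu : phi u = d ++ drop (size d) (phi u).
  rewrite -{1}(cat_take_drop (size d) (phi u)); congr (_ ++ _).
  by rewrite -(takel_cat r ltu) -Er take_size_cat.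
have pv : prefix (drop (size d) (phi u)) (phi v).
  move/eqP: Er; rewrite Eu -catA eqseq_cat // eqxx => /eqP ->.
  by rewrite drop_size_cat // prefix_prefix.
have [v1 [z [pv1 Ez qz]]] := prefix_morphism_split aS vS pv.
apply: u_free; exists d, (phi v1), z; split=> //.
- by rewrite -Ez.
- exists (phi [:: a]) => //; split; first exact: suffix_drop.
  by move=> E; rewrite E ltnn in ltd.
- exact: image_factorization_morphism (words_prefix pv1 vS).
- move/(congr1 size)/eqP; rewrite size_cat addn_eq0 size_drop subn_eq0.
  by rewrite leqNgt lti.
Qed.

Lemma interference_free_occ (v : seq T) :
  v \in words Sigma -> occ (phi u) (phi v) = occ u v.
Proof.
elim: v => [|a v IHv] /=; first by rewrite morphism_on_nil.
move=> avS; have /andP[/= aS vS] := avS.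
rewrite occ_cons -IHv // -interference_free_prefix // morphism_on_cons //.
have := fun i => @interference_free_no_straddle a v i aS vS.
(* The image of [a] is non-empty, so its first position matches the position of [a] in [a :: v]; the
   positions in [w] contribute nothing. *)
case: (phi [:: a]) (injective_morphism_neq0 (u := [:: a])) => [|b w] nz nos.
  by case: nz => //; rewrite inE /= aS.
rewrite cat_cons occ_cons occ_cat_no_straddle // => i ltiw.
exact: (nos i.+1).
Qed.

End SingleWord.

End InjectiveMorphism.

Theorem theorem23 (T : eqType) (Sigma Gamma : {pred T})
  (phi : seq T -> seq T)
  (phiM : morphism_on Sigma Gamma phi)
  (phi_inj : {in words Sigma &, injective phi})
  (u v : seq T) (uS : u \in words Sigma) (vS : v \in words Sigma)
  (u_neq0 : u <> [::])
  (k : nat) (k_ge1 : 1 <= k)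
  (u_iter : forall i, i < k -> iter i phi u \in words Sigma)
  (v_iter : forall i, i < k -> iter i phi v \in words Sigma)
  (phi_free : interference_free Sigma phi
                (fun w => exists2 i, i < k & w = iter i phi u)) :
  occ u v = occ (iter k phi u) (iter k phi v).
Proof.
(* Interference-freeness speaks only of non-empty words, so each iterate of [u] must be shown
   non-empty before it is used. *)
have iter_neq0 i : i <= k -> iter i phi u <> [::].
  elim: i => //= i IHi ltik.
  apply: (injective_morphism_neq0 phiM phi_inj); first exact: u_iter.
  exact/IHi/ltnW.
suff H i : i <= k -> occ u v = occ (iter i phi u) (iter i phi v) by exact: H.
elim: i => //= i IHi ltik; rewrite IHi ?(ltnW ltik) //.
have [] := phi_free (iter i phi u); first by exists i.
  exact/iter_neq0/ltnW.
move=> free outer; rewrite (interference_free_occ phiM phi_inj) //.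
- exact: u_iter.
- exact/iter_neq0/ltnW.
- exact: v_iter.
Qed.
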